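(* Let $K$ be a compact Hausdorff space and let $\mathcal{H}$ be a finite-dimensional real Hilbert space with $\dim(\mathcal{H})=n\geq 2$. Suppose $t_0\in K$ and $x_0\in S(\mathcal{H})$. Then every element in $A(t_0,x_0)$ can be approximated in norm by a finite convex combination of elements in $A(t_0,x_0)\cap \partial_{e}(\mathcal{B}_{C(K,\mathcal{H})})$.
   Context: $C(K,\mathcal{H})$ is the Banach space of all continuous functions from $K$ to $\mathcal{H}$, with the supremum norm. For a Banach space $X$, $S(X)$ is its unit sphere and $\mathcal{B}_X$ its closed unit ball; $\partial_e(L)$ is the set of extreme points of a convex set $L$. For $t_0\in K$ and $x_0\in S(\mathcal{H})$, $A(t_0,x_0):=\{ a\in S(C(K,\mathcal{H})) : a(t_0) = x_0\}$. ''Can be approximated in norm'' means: for every $\varepsilon>0$ there is such a convex combination at distance less than $\varepsilon$. *)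

(* Defs.v *)
From HB Require Import structures.
From mathcomp Require Import all_boot all_order all_algebra.
From mathcomp Require Import all_classical all_reals all_analysis.

Set Implicit Arguments.
Unset Strict Implicit.
Unset Printing Implicit Defensive.

Import Order.TTheory GRing.Theory Num.Theory.
Import numFieldNormedType.Exports.

Local Open Scope classical_set_scope.
Local Open Scope ring_scope.

HB.mixin Record NormedModule_isHilbert (R : realType) (H : Type)
    & NormedModule R H := {
  inner : {dot H for idfun} ;
  norm_inner : forall x : H, `|x| = Num.sqrt (inner x x)
}.

#[short(type="hilbertType")]
HB.structure Definition Hilbert (R : realType) :=
  {H of CompleteNormedModule R H & NormedModule_isHilbert R H}.

#[short(type="finHilbertType")]
HB.structure Definition FinHilbert (R : realType) :=
  {H of Hilbert R H & Vector R H}.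

Definition extreme_points (R : realType) (V : lmodType R) (L : set V) : set V :=
  [set x | L x /\ forall (y z : V) (s : R), L y -> L z -> 0 < s < 1 ->
     x = s *: y + (1 - s) *: z -> y = x /\ z = x].

Section continuous_functions.
Context {R : realType} (K : topologicalType) (H : normedModType R).

(* C(K, H) as a subset of the R-module of all functions K -> H. Its norm
   supnorm is only meaningful on bounded functions (sup is 0 on unbounded sets),
   hence on all of C(K, H) when K is compact. *)
Definition C_ : set (K -> H) := [set f | continuous f].

Definition supnorm (f : K -> H) : R := sup (range (fun t => `|f t|)).

Definition C_sphere : set (K -> H) := [set f | C_ f /\ supnorm f = 1].

Definition C_ball : set (K -> H) := [set f | C_ f /\ supnorm f <= 1].

Definition A_ (t0 : K) (x0 : H) : set (K -> H) :=
  [set a | C_sphere a /\ a t0 = x0].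

End continuous_functions.

Definition is_convex_combination (R : realType) (V : lmodType R) (S : set V)
    (v : V) : Prop :=
  exists (m : nat) (c : 'I_m -> R) (b : 'I_m -> V),
    [/\ forall i, 0 <= c i, \sum_(i < m) c i = 1, forall i, S (b i)
      & v = \sum_(i < m) c i *: b i].

(* Main.v *)
(** Everything takes place in the plane spanned by [x0] and a unit vector [e]
orthogonal to [x0]. Write [x], [y] for the coordinates of [a t] in that plane,
and [rho] for the radius of the circle cut out of the unit sphere by the
translate of the plane through [a t]; put [sg = sqrt (rho^2 - x^2)], so that
[|y| <= sg]. If [y = mu * sg], then [(x, y)] is the barycentre of the two points
[(x, sg)] and [(x, - sg)] of the circle with weights [(1 + mu) / 2] and
[(1 - mu) / 2]; these weights depend on [t]. To get constant weights, join the
two points by an arc of the circle through [(rho, 0)], and take [N] functions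
following this arc such that, at each [t], about [N (1 + mu) / 2] of them sit at
[(x, sg)], the others at [(x, - sg)], and at most one is in transit. Their mean
is within [O(1/N)] of [a t]. Replacing [mu = y / sg] by [y / (sg + d)] makes it
continuous where [sg] vanishes, at the cost of an error [d]. Where [a t = x0] the
circle is the unit circle and [sg = 0], so all these functions take the value
[x0]; having norm 1 everywhere, they are extreme points by strict convexity. *)

Require Import Defs.
From HB Require Import structures.
From mathcomp Require Import all_boot all_order all_algebra.
From mathcomp Require Import all_classical all_reals all_analysis.
From mathcomp Require Import ring lra.

Set Implicit Arguments.
Unset Strict Implicit.
Unset Printing Implicit Defensive.

Import Order.TTheory GRing.Theory Num.Theory.
Import numFieldNormedType.Exports.
Local Open Scope classical_set_scope.
Local Open Scope ring_scope.

(** * Ramps and their sums *)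

(** The truncation of [2 * v - 1] to [[-1, 1]], written as a difference of distances so that sums
    over integer shifts telescope. *)
Definition ramp {R : numDomainType} (v : R) : R := `|v| - `|v - 1|.

Lemma ramp_le1 (R : realDomainType) (v : R) : `|ramp v| <= 1.
Proof.
by rewrite (le_trans (ler_dist_dist _ _))// opprB addrCA subrr addr0 normr1.
Qed.

Lemma ramp_ge1 (R : realDomainType) (v : R) : 1 <= v -> ramp v = 1.
Proof. by move=> v1; rewrite /ramp !ger0_norm; lra. Qed.

Lemma ramp_le0 (R : realDomainType) (v : R) : v <= 0 -> ramp v = -1.
Proof. by move=> v0; rewrite /ramp !ler0_norm; lra. Qed.

Lemma sum_ramp (R : realDomainType) (N : nat) (v : R) : 0 <= v <= N%:R ->
  \sum_(j < N) ramp (v - j%:R) = 2 * v - N%:R.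
Proof.
move=> /andP[v0 vN].
have -> : 2 * v - N%:R = `|v - 0| - `|v - N%:R|.
  by rewrite subr0 ger0_norm// ler0_norm; lra.
elim: N {vN} => [|N IH]; first by rewrite big_ord0 subrr.
rewrite big_ord_recr /= IH /ramp (_ : v - N.+1%:R = v - N%:R - 1); first by ring.
by rewrite -natr1; ring.
Qed.

(* At most one of the numbers [v - j] lies strictly between [0] and [1]. *)
Lemma sum_ramp_le (R : realDomainType) (f : R -> R) (M : R) (N : nat) (v : R) :
  f 1 = 0 -> f (-1) = 0 -> (forall s, `|s| <= 1 -> `|f s| <= M) ->
  `|\sum_(j < N) f (ramp (v - j%:R))| <= M.
Proof.
move=> f1 fN1 fM.
have M0 : 0 <= M by rewrite (le_trans _ (fM 1 _)) ?normr1.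
elim: N => [|N IH]; first by rewrite big_ord0 normr0.
rewrite big_ord_recr /=; have [vN|Nv] := leP v N%:R.
  by rewrite (@ramp_le0 _ (v - _)) ?fN1 ?addr0// subr_le0.
rewrite big1 ?add0r; first exact/fM/ramp_le1.
move=> j _; rewrite ramp_ge1// lerBrDr (le_trans _ (ltW Nv))//.
by rewrite nat1r ler_nat.
Qed.

(** * Arcs of a circle and averages along them *)

(* For [s] from [1] to [-1], [(arc_x rho x s, arc_y rho x s)] runs on the circle
   of radius [rho] from [(x, sg)] through [(rho, 0)] to [(x, - sg)]. *)
Definition arc_x {R : numDomainType} (rho x s : R) : R := rho - `|s| * (rho - x).

(* [Num.sqrt] is [0] on negative numbers: the first factor is the continuous
   function [sign(s) * sqrt |s|]. *)
Definition arc_y {R : rcfType} (rho x s : R) : R :=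
  (Num.sqrt s - Num.sqrt (- s)) * Num.sqrt ((rho - x) * (rho + arc_x rho x s)).

Lemma arc_x_itv (R : realDomainType) (rho x s : R) :
  `|x| <= rho -> `|s| <= 1 -> x <= arc_x rho x s <= rho.
Proof.
rewrite /arc_x ler_norml => /andP[xl xu] s1; have := normr_ge0 s; nra.
Qed.

(** With [X = arc_x rho x s], [arc_y] squares to [(rho - X) * (rho + X)]: its first factor squares
    to [|s|], and [|s| * (rho - x) = rho - X]. *)
Lemma arc_circle (R : rcfType) (rho x s : R) : `|x| <= rho -> `|s| <= 1 ->
  arc_x rho x s ^+ 2 + arc_y rho x s ^+ 2 = rho ^+ 2.
Proof.
move=> xr s1; have /andP[xl xu] := arc_x_itv xr s1.
move: (xr); rewrite ler_norml => /andP[xr1 xr2].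
rewrite /arc_y exprMn sqr_sqrtr; last by apply: mulr_ge0; lra.
have -> : (Num.sqrt s - Num.sqrt (- s)) ^+ 2 = `|s|.
  have [s0|s0] := leP 0 s.
    by rewrite (@ler0_sqrtr _ (- s)) ?oppr_le0// subr0 sqr_sqrtr// ger0_norm.
  rewrite (@ler0_sqrtr _ s) ?ltW// sub0r sqrrN sqr_sqrtr ?oppr_ge0 ?ltW//.
  by rewrite ltr0_norm.
by rewrite /arc_x; ring.
Qed.

Lemma arc_y_le (R : rcfType) (rho x s : R) : `|x| <= rho -> `|s| <= 1 ->
  `|arc_y rho x s| <= rho.
Proof.
move=> xr s1; have e := arc_circle xr s1.
rewrite -(@ler_pXn2r _ 2%N) ?nnegrE ?(le_trans _ xr)// real_normK ?num_real//.
by rewrite -e lerDr sqr_ge0.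
Qed.

Lemma arc_x1 (R : numDomainType) (rho x s : R) : `|s| = 1 -> arc_x rho x s = x.
Proof. by move=> s1; rewrite /arc_x s1; ring. Qed.

Lemma arc_y1 (R : rcfType) (rho x s : R) : `|s| = 1 ->
  arc_y rho x s = s * Num.sqrt (rho ^+ 2 - x ^+ 2).
Proof.
move=> s1; rewrite /arc_y arc_x1//.
have -> : (rho - x) * (rho + x) = rho ^+ 2 - x ^+ 2 by ring.
congr (_ * _); move/eqP: s1; rewrite eqr_norml ler01 andbT.
by move=> /orP[] /eqP ->; rewrite ?opprK sqrtr1 ler0_sqrtr; lra.
Qed.

Lemma arc_mean (R : rcfType) (N : nat) (d rho x y : R) : (0 < N)%N -> 0 < d ->
  rho <= 1 -> x ^+ 2 + y ^+ 2 <= rho ^+ 2 -> 0 <= rho ->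
  let mu := y / (Num.sqrt (rho ^+ 2 - x ^+ 2) + d) in
  let s (j : 'I_N) := ramp (N%:R * ((1 + mu) / 2) - j%:R) in
  `|N%:R^-1 * \sum_j arc_x rho x (s j) - x| <= 2 / N%:R /\
  `|N%:R^-1 * \sum_j arc_y rho x (s j) - y| <= 2 / N%:R + d.
Proof.
move=> N0 d0 r1 xyr r0 mu s.
have NR0 : 0 < N%:R :> R by rewrite ltr0n.
set sg := Num.sqrt _ in mu s *.
have x2 : x ^+ 2 <= rho ^+ 2 by nra.
have sg0 : 0 <= sg by exact: sqrtr_ge0.
have sg2 : sg ^+ 2 = rho ^+ 2 - x ^+ 2 by rewrite sqr_sqrtr// subr_ge0.
have sgr : sg <= 1.
  by rewrite -(@ler_pXn2r _ 2%N) ?nnegrE// sg2; nra.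
have xr : `|x| <= rho.
  by rewrite -(@ler_pXn2r _ 2%N) ?nnegrE// real_normK ?num_real.
have ysg : `|y| <= sg.
  by rewrite -(@ler_pXn2r _ 2%N) ?nnegrE// real_normK ?num_real// sg2; lra.
have sgd : 0 < sg + d by lra.
have muE : mu * (sg + d) = y by rewrite /mu divfK// gt_eqF.
have mu1 : `|mu| <= 1.
  by rewrite /mu normrM normfV (gtr0_norm sgd) ler_pdivrMr//; lra.
have ss : \sum_j s j = N%:R * mu.
  rewrite /s sum_ramp; first by field.
  move: mu1; rewrite ler_norml => /andP[m1 m2].
  apply/andP; split; first by apply: mulr_ge0; [exact: ltW|lra].
  by rewrite -[leRHS]mulr1 ler_pM2l//; lra.
(* [F] will be the deviation from the endpoint values, zero at [s = 1] and [s = -1], so at most the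
   one index in transit contributes. *)
have mean_err (F : R -> R) : F 1 = 0 -> F (-1) = 0 ->
    (forall u, `|u| <= 1 -> `|F u| <= 2) -> `|N%:R^-1 * \sum_j F (s j)| <= 2 / N%:R.
  move=> F1 FN1 F2; rewrite normrM normfV (gtr0_norm NR0) mulrC.
  rewrite ler_pM2r ?invr_gt0//; exact: sum_ramp_le.
split.
  rewrite [X in `|X|](_ : _ = N%:R^-1 * \sum_j (arc_x rho x (s j) - x)); last first.
    by rewrite [in RHS]sumrB sumr_const card_ord mulrBr -[x *+ N]mulr_natl mulKf// lt0r_neq0.
  apply: (mean_err (fun u => arc_x rho x u - x)).
  - by rewrite arc_x1 ?normr1// subrr.
  - by rewrite arc_x1 ?normrN1// subrr.
  - move=> u u1; have := arc_x_itv xr u1.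
    by move: xr; rewrite !ler_norml; lra.
(* The endpoint values [s j * sg] average to [mu * sg], which is [y - mu * d]. *)
rewrite [X in `|X|](_ : _ =
    N%:R^-1 * \sum_j (arc_y rho x (s j) - s j * sg) - mu * d); last first.
  rewrite sumrB -mulr_suml ss -muE; field; exact: lt0r_neq0.
rewrite (le_trans (ler_normB _ _))// lerD//.
  apply: (mean_err (fun u => arc_y rho x u - u * sg)).
  - by rewrite arc_y1 ?normr1// subrr.
  - by rewrite arc_y1 ?normrN1// subrr.
  - move=> u u1; rewrite (le_trans (ler_normB _ _))//.
    have := arc_y_le xr u1; rewrite (normrM u) (ger0_norm sg0).
    by have := normr_ge0 u; nra.
by rewrite normrM (gtr0_norm d0) ger_pMl.
Qed.

(** * Inner product geometry *)

Section inner_product.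
Context {R : realType} {H : hilbertType R}.
Implicit Types u v w : H.

Lemma innerC u v : inner u v = inner v u.
Proof. by rewrite hermC /= expr0 mul1r. Qed.

Lemma innerDl u v w : inner (u + v) w = inner u w + inner v w.
Proof. by rewrite linearDl. Qed.

Lemma innerZl c u v : inner (c *: u) v = c * inner u v.
Proof. by rewrite linearZl_LR. Qed.

Lemma innerZr c u v : inner u (c *: v) = c * inner u v.
Proof. by rewrite innerC innerZl innerC. Qed.

Lemma inner_ge0 u : 0 <= inner u u.
Proof.
have [->|u0] := eqVneq u 0; first by rewrite linear0l.
exact/ltW/neq0_dnorm_gt0.
Qed.

Lemma inner_norm u : inner u u = `|u| ^+ 2.
Proof. by rewrite norm_inner sqr_sqrtr// inner_ge0. Qed.

Lemma normD2 u v : `|u + v| ^+ 2 = `|u| ^+ 2 + 2 * inner u v + `|v| ^+ 2.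
Proof.
rewrite -!inner_norm linearDl/= !linearDr/= (innerC v u); ring.
Qed.

Lemma normB2 u v : `|u - v| ^+ 2 = `|u| ^+ 2 - 2 * inner u v + `|v| ^+ 2.
Proof. by rewrite normD2 normrN linearNr/=; ring. Qed.

(** Polarization reduces this to continuity of the norm. *)
Lemma continuous_inner (T : topologicalType) (f : T -> H) v :
  continuous f -> continuous (fun t => inner (f t) v).
Proof.
move=> cf.
have -> : (fun t => inner (f t) v) =
    (fun t => 4^-1 * (`|f t + v| ^+ 2 - `|f t - v| ^+ 2)).
  by apply/funext => t; rewrite normD2 normB2; field.
move=> t; apply: cvgM; first exact: cvg_cst.
have cD w : {for t, continuous (fun t => `|f t + w| ^+ 2)}.
  have cfw : `|f z + w| @[z --> t] --> `|f t + w|.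
    by apply: cvg_norm; apply: cvgD; [exact: cf|exact: cvg_cst].
  exact: (cvgM cfw cfw).
exact: (cvgB (cD v) (cD (- v))).
Qed.

(** Pairing with [u] exhibits 1 as a weighted mean of [inner v u] and [inner w u], both at most 1.
    So both equal 1, and expanding [|v - u| ^+ 2] and [|w - u| ^+ 2] gives at most 0. *)
Lemma sphere_strictly_convex u v w (s : R) : 0 < s < 1 -> `|u| = 1 ->
  `|v| <= 1 -> `|w| <= 1 -> u = s *: v + (1 - s) *: w -> v = u /\ w = u.
Proof.
move=> /andP[s0 s1] u1 v1 w1 e.
have eu : 1 = s * inner v u + (1 - s) * inner w u.
  have : inner u u = 1 by rewrite inner_norm u1 expr1n.
  by rewrite {1}e innerDl !innerZl.
have := normB2 v u; have := normB2 w u; rewrite u1 expr1n.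
move=> ew ev.
have v2 : `|v| ^+ 2 <= 1 by rewrite expr_le1.
have w2 : `|w| ^+ 2 <= 1 by rewrite expr_le1.
have vu := sqr_ge0 `|v - u|; have wu := sqr_ge0 `|w - u|.
split; apply/eqP; rewrite -subr_eq0 -normr_eq0 -sqrf_eq0; apply/eqP; nra.
Qed.

End inner_product.

(** Gram-Schmidt applied to a vector outside the line of [u]. *)
Lemma exists_orthogonal_unit (R : realType) (H : finHilbertType R) (u : H) :
  (1 < \dim (fullv : {vspace H}))%N -> `|u| = 1 ->
  exists v : H, inner u v = 0 /\ `|v| = 1.
Proof.
move=> dimH u1.
have [w wu] : exists w : H, w \notin <[u]>%VS.
  apply: contrapT => /forallNP allw; move: dimH; rewrite ltnNge.
  move/negP; apply; rewrite (leq_trans _ (dim_span [:: u]))// span_seq1.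
  by apply/dimvS/subvP => w _; apply: contrapT => /negP; exact: allw.
pose v := w - inner w u *: u.
have v0 : `|v| != 0.
  rewrite normr_eq0 subr_eq0; apply: contraNneq wu => ->.
  by rewrite memvZ// memv_line.
exists (`|v|^-1 *: v); split; last by rewrite normrZ normfV normr_id mulVf.
rewrite innerZr /v linearBr/= innerZr inner_norm u1 (innerC u w); ring.
Qed.

(** * Supremum norm and extreme points *)

Section supremum_norm.
Context {R : realType} {K : topologicalType} {H : normedModType R}.
Implicit Types f : K -> H.

Lemma norm_le_supnorm f t : compact [set: K] -> continuous f -> `|f t| <= supnorm f.
Proof.
move=> cK cf; apply: ub_le_sup => /=; last by exists t.
have /compact_bounded[M [_ fM]] : compact (range f).
  by apply: continuous_compact cK; exact: continuous_subspaceT.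
(* Boundedness provides every real above [M] as a bound, not [M] itself. *)
exists (M + 1) => _ [x _ <-].
by apply: (fM (M + 1)); [rewrite ltrDl|exists x].
Qed.

(** The point [t0] excludes an empty range, whose [sup] defaults to 0. *)
Lemma supnorm_le f (t0 : K) (M : R) : (forall t, `|f t| <= M) -> supnorm f <= M.
Proof.
move=> fM; apply: ge_sup; first by exists `|f t0|, t0.
by move=> _ [t _ <-].
Qed.

Lemma supnorm_unimodular f (t0 : K) : (forall t, `|f t| = 1) -> supnorm f = 1.
Proof.
move=> f1; rewrite -[RHS](sup1 1); congr sup; apply/seteqP; split => [_ [t _ <-]|_ ->].
  exact: f1.
by exists t0.
Qed.

End supremum_norm.

Lemma unimodular_extreme (R : realType) (K : topologicalType)
    (H : hilbertType R) (f : K -> H) : compact [set: K] -> K ->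
  continuous f -> (forall t, `|f t| = 1) -> extreme_points (@C_ball R K H) f.
Proof.
move=> cK t0 cf f1; split.
  by split=> //; rewrite (supnorm_unimodular t0).
move=> y z s [cy y1] [cz z1] s01 e.
have yz t : y t = f t /\ z t = f t.
  apply: (sphere_strictly_convex s01) => //.
  - by rewrite (le_trans (norm_le_supnorm _ cK cy)).
  - by rewrite (le_trans (norm_le_supnorm _ cK cz)).
  - by rewrite e.
by split; apply/funext => t; case: (yz t).
Qed.

(** Pythagoras: the part of [v] orthogonal to the plane is kept, while its coordinates in the plane
    become [p] and [q]. *)
Lemma move_in_plane_norm (R : realType) (H : hilbertType R) (e1 e2 v : H)
    (p q : R) : `|e1| = 1 -> `|e2| = 1 -> inner e1 e2 = 0 ->
  `|v + (p - inner v e1) *: e1 + (q - inner v e2) *: e2| ^+ 2 =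
  `|v| ^+ 2 - inner v e1 ^+ 2 - inner v e2 ^+ 2 + p ^+ 2 + q ^+ 2.
Proof.
move=> e1n e2n e12.
rewrite !normD2 !innerZr innerDl !innerZl e12 !normrZ !exprMn e1n e2n.
by rewrite !real_normK ?num_real//; ring.
Qed.

Lemma bessel2 (R : realType) (H : hilbertType R) (e1 e2 v : H) :
  `|e1| = 1 -> `|e2| = 1 -> inner e1 e2 = 0 ->
  inner v e1 ^+ 2 + inner v e2 ^+ 2 <= `|v| ^+ 2.
Proof.
move=> e1n e2n e12; have := move_in_plane_norm v 0 0 e1n e2n e12.
set w := `|_ + _|; have := sqr_ge0 w; nra.
Qed.

(** * Continuity of the arc coordinates *)

Section continuity.
Context {R : realType} {T : topologicalType}.
Implicit Types f rho x s : T -> R.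

Lemma continuous_sqrt f : continuous f -> continuous (fun t => Num.sqrt (f t)).
Proof. by move=> cf t; apply: continuous_comp (cf t) _; exact: sqrt_continuous. Qed.

Lemma continuous_sqr f : continuous f -> continuous (fun t => f t ^+ 2).
Proof. by move=> cf t; exact: cvgM (cf t) (cf t). Qed.

Lemma continuous_ramp f : continuous f -> continuous (fun t => ramp (f t)).
Proof.
move=> cf t; apply: cvgB; apply: cvg_norm; first exact: cf.
by apply: cvgB; [exact: cf|exact: cvg_cst].
Qed.

Lemma continuous_arc_x rho x s : continuous rho -> continuous x ->
  continuous s -> continuous (fun t => arc_x (rho t) (x t) (s t)).
Proof.
move=> cr cx cs t; apply: cvgB; first exact: cr.
by apply: cvgM; [apply: cvg_norm; exact: cs|apply: cvgB; [exact: cr|exact: cx]].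
Qed.

Lemma continuous_arc_y rho x s : continuous rho -> continuous x ->
  continuous s -> continuous (fun t => arc_y (rho t) (x t) (s t)).
Proof.
move=> cr cx cs t; apply: cvgM.
  apply: cvgB; apply: continuous_sqrt; first exact: cs.
  by move=> u; apply: cvgN; exact: cs.
apply: continuous_sqrt => u; apply: cvgM.
  by apply: cvgB; [exact: cr|exact: cx].
by apply: cvgD; [exact: cr|exact: continuous_arc_x].
Qed.

End continuity.

(** * Unimodular functions following the arc *)

Section sphere_maps.
Context {R : realType} {K : topologicalType} {H : hilbertType R}.
Variables (e1 e2 : H) (a : K -> H) (N : nat) (d : R).
Hypotheses (e1n : `|e1| = 1) (e2n : `|e2| = 1) (e12 : inner e1 e2 = 0).
Hypotheses (ca : continuous a) (a1 : forall t, `|a t| <= 1).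
Hypotheses (N0 : (0 < N)%N) (d0 : 0 < d).

Let x t := inner (a t) e1.
Let y t := inner (a t) e2.

(** [|a t| ^+ 2 - x t ^+ 2 - y t ^+ 2] is the squared norm of the part of [a t] orthogonal to [e1]
    and [e2]. *)
Definition radius t := Num.sqrt (1 - `|a t| ^+ 2 + x t ^+ 2 + y t ^+ 2).

Definition mean_pos t := y t / (Num.sqrt (radius t ^+ 2 - x t ^+ 2) + d).

(** [N * (1 + mean_pos t) / 2] counts the functions due at the upper endpoint; index [j] is there
    once this count reaches [j + 1]. *)
Definition arc_pos (j : 'I_N) t :=
  ramp (N%:R * ((1 + mean_pos t) / 2) - j%:R).

Definition sphere_map (j : 'I_N) t : H :=
  a t + (arc_x (radius t) (x t) (arc_pos j t) - x t) *: e1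
      + (arc_y (radius t) (x t) (arc_pos j t) - y t) *: e2.

Let radius2 t : radius t ^+ 2 = 1 - `|a t| ^+ 2 + x t ^+ 2 + y t ^+ 2.
Proof.
rewrite sqr_sqrtr//; have : `|a t| ^+ 2 <= 1 by rewrite expr_le1.
by have := sqr_ge0 (x t); have := sqr_ge0 (y t); lra.
Qed.

Let radius_ge0 t : 0 <= radius t. Proof. exact: sqrtr_ge0. Qed.

Let radius_le1 t : radius t <= 1.
Proof.
rewrite -(@ler_pXn2r _ 2%N) ?nnegrE// radius2.
by have := bessel2 (a t) e1n e2n e12; rewrite -/(x t) -/(y t); lra.
Qed.

Let disc t : x t ^+ 2 + y t ^+ 2 <= radius t ^+ 2.
Proof.
by have : `|a t| ^+ 2 <= 1 by [rewrite expr_le1]; rewrite radius2; lra.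
Qed.

Lemma sphere_map_norm j t : `|sphere_map j t| = 1.
Proof.
have xr : `|x t| <= radius t.
  rewrite -(@ler_pXn2r _ 2%N) ?nnegrE// real_normK ?num_real//.
  by rewrite (le_trans _ (disc t))// lerDl sqr_ge0.
apply/eqP; rewrite -(@eqrXn2 _ 2%N)// expr1n move_in_plane_norm//.
by rewrite -addrA arc_circle ?ramp_le1// radius2; apply/eqP; ring.
Qed.

(** Here [radius t = x t = 1], so the arc shrinks to a point and [arc_pos j t] does not matter. *)
Lemma sphere_map_fix j t : a t = e1 -> sphere_map j t = e1.
Proof.
move=> ate; have xt : x t = 1 by rewrite /x ate inner_norm e1n expr1n.
have yt : y t = 0 by rewrite /y ate.
have rt : radius t = 1.
  apply/eqP; rewrite -(@eqrXn2 _ 2%N)// radius2 xt yt ate e1n.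
  by apply/eqP; ring.
rewrite /sphere_map /arc_y /arc_x rt xt yt ate.
by rewrite !subrr mul0r sqrtr0 !mulr0 !subr0 subrr !scale0r !addr0.
Qed.

Let cx : continuous x. Proof. exact: continuous_inner. Qed.
Let cy : continuous y. Proof. exact: continuous_inner. Qed.

Let cradius : continuous radius.
Proof.
apply: continuous_sqrt => t; apply: cvgD; last exact: continuous_sqr.
apply: cvgD; last exact: continuous_sqr.
apply: cvgB; first exact: cvg_cst.
suff cn : continuous (fun u => `|a u|) by exact: continuous_sqr cn t.
by move=> u; apply: cvg_norm; exact: ca.
Qed.

Let carc_pos j : continuous (arc_pos j).
Proof.
apply: continuous_ramp => t; apply: cvgB; last exact: cvg_cst.
apply: cvgM; first exact: cvg_cst.
apply: cvgM; last exact: cvg_cst.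
apply: cvgD; first exact: cvg_cst.
apply: cvgM; first exact: cy.
(* [d > 0] keeps the denominator positive where the square root vanishes. *)
apply: cvgV; first by rewrite gt_eqF// ltr_wpDl// sqrtr_ge0.
apply: cvgD; last exact: cvg_cst.
have cd : continuous (fun u => radius u ^+ 2 - x u ^+ 2).
  by move=> u; apply: cvgB; [exact: continuous_sqr cradius u|exact: continuous_sqr].
exact: continuous_sqrt cd t.
Qed.

Lemma continuous_sphere_map j : continuous (sphere_map j).
Proof.
have cX := continuous_arc_x cradius cx (@carc_pos j).
have cY := continuous_arc_y cradius cx (@carc_pos j).
move=> t; apply: cvgD; first apply: cvgD; first exact: ca.
  by apply: cvgZr_tmp; apply: cvgB; [exact: cX|exact: cx].
by apply: cvgZr_tmp; apply: cvgB; [exact: cY|exact: cy].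
Qed.

(** The error lies in the plane of [e1] and [e2]; the triangle inequality adds the two coordinate
    errors of [arc_mean]. *)
Lemma sphere_map_mean t :
  `|a t - \sum_j N%:R^-1 *: sphere_map j t| <= 4 / N%:R + d.
Proof.
have [mx my] := arc_mean N0 d0 (radius_le1 t) (disc t) (radius_ge0 t).
have NN : N%:R != 0 :> R by rewrite pnatr_eq0 -lt0n.
have -> : \sum_j N%:R^-1 *: sphere_map j t = a t +
    (N%:R^-1 * (\sum_j arc_x (radius t) (x t) (arc_pos j t)) - x t) *: e1 +
    (N%:R^-1 * (\sum_j arc_y (radius t) (x t) (arc_pos j t)) - y t) *: e2.
  have meanB (F : 'I_N -> R) (z : R) :
      N%:R^-1 * \sum_j (F j - z) = N%:R^-1 * (\sum_j F j) - z.
    by rewrite sumrB sumr_const card_ord mulrBr -[z *+ N]mulr_natl mulKf.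
  rewrite -scaler_sumr /sphere_map 2!big_split/= -!scaler_suml.
  rewrite !scalerDr !scalerA !meanB sumr_const card_ord.
  by rewrite -[a t *+ N]scaler_nat scalerA mulVf// scale1r.
rewrite -addrA opprD addrA subrr sub0r normrN (le_trans (ler_normD _ _))//.
rewrite !normrZ e1n e2n !mulr1 (_ : 4 / N%:R + d = 2 / N%:R + (2 / N%:R + d)).
  exact: lerD.
by field.
Qed.

End sphere_maps.

Theorem corollary4p8 (R : realType) (K : topologicalType) (H : finHilbertType R)
    (n : nat) (K_compact : compact [set: K]) (K_hausdorff : hausdorff_space K)
    (dimH : \dim (fullv : {vspace H}) = n) (n_ge2 : (2 <= n)%N)
    (t0 : K) (x0 : H) (x0_sphere : `|x0| = 1)
    (a : K -> H) (Aa : A_ t0 x0 a) (eps : R) (eps_gt0 : 0 < eps) :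
  exists g : K -> H,
    is_convex_combination (A_ t0 x0 `&` extreme_points (@C_ball R K H)) g /\
    supnorm (a - g) < eps.
Proof.
case: Aa => -[ca na] at0.
have a1 t : `|a t| <= 1 by rewrite -na; exact: norm_le_supnorm.
have [e [xe e1]] : exists e : H, inner x0 e = 0 /\ `|e| = 1.
  by apply: exists_orthogonal_unit => //; rewrite dimH.
(* With [d = eps / 4] and [N > 16 / eps], the error [4 / N + d] is below [eps / 2]. *)
have d0 : 0 < eps / 4 by rewrite divr_gt0.
pose N := (Num.truncn (16 / eps)).+1.
have N0 : 0 < N%:R :> R by rewrite ltr0n.
have NE : 4 / N%:R < eps / 4.
  have : 16 / eps < N%:R by exact: truncnS_gt.
  by rewrite !ltr_pdivrMr//; lra.
pose u := @sphere_map R K H x0 e a N (eps / 4).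
exists (\sum_(j < N) N%:R^-1 *: u j); split; last first.
  (* A supremum inherits only non-strict bounds, so the uniform bound itself must lie strictly below
     [eps]. *)
  apply: (@le_lt_trans _ _ (4 / N%:R + eps / 4)); last lra.
  apply: (supnorm_le t0) => t.
  by rewrite fctE fct_sumE; exact: sphere_map_mean.
exists N, (fun=> N%:R^-1), u; split => //.
  by rewrite sumr_const card_ord -[_^-1 *+ N]mulr_natl mulfV// gt_eqF.
move=> j; have cu : continuous (u j) by exact: continuous_sphere_map.
have u1 t : `|u j t| = 1 by exact: sphere_map_norm.
split; last exact: unimodular_extreme.
by split; [split=> //; exact: supnorm_unimodular|exact: sphere_map_fix].
Qed.
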